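(* A rectair is a losing position ($\mathcal{P}$-position) of the game CRIM if and only if it is balanced.
   Context: A partition is a finite weakly decreasing sequence $\lambda=[\lambda_1,\ldots,\lambda_r]$ of positive integers, called its parts; the empty partition $[\,]$ is allowed. Exponents denote repeated parts. Its conjugate is $\lambda'=[\lambda'_1,\ldots,\lambda'_{\lambda_1}]$, where $\lambda'_k$ is the largest $i$ with $\lambda_i\ge k$. The rank of $\lambda$ is $|r-\lambda_1|$. CRIM is the impartial two-player game whose positions are partitions. From $\lambda=[\lambda_1,\ldots,\lambda_r]$, a row move deletes the part $\lambda_i$ for some $1\le i\le r$. A column move takes the conjugate of the partition that results from making a row move on $\lambda'$ (i.e. it removes one column of the Young diagram). Play is normal play: the player to move at the terminal position $[\,]$ loses. A $\mathcal{P}$-position (losing position) is one from which the player who has just moved can force a win. A rectair is a partition that is either $[\,]$ or of the form $R^k_{r,c}=[c^{\,r-k},c-1,c-2,\ldots,c-k]$, where $r,c$ are positive integers and $0\le k<\min(r,c)$. A rectair $R^k_{r,c}$ is balanced if its rank $|r-c|$ is even, $r\ge2$ and $c\ge2$, and, when $r$ and $c$ are odd, $k<\min(r,c)-1$. The empty rectair $[\,]$ is balanced. *)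

(* Defs.v *)
From mathcomp Require Import all_boot ssrint.

Set Implicit Arguments.
Unset Strict Implicit.
Unset Printing Implicit Defensive.

(** Part number [i] (counted from 1) of a partition [l] is [nth 0 l i.-1]. *)

Definition is_partition (s : seq nat) : bool := sorted geq s && all (ltn 0) s.

Record int_partition : Type :=
  Partition { parts :> seq nat; partitionP : is_partition parts }.

Definition empty_partition : int_partition := @Partition [::] isT.

(** The difference is taken in [int], so this is the absolute difference. *)
Definition rank (l : int_partition) : nat := `|size l - head 0 l|.

(** [last_ge s k] is the largest [i], counted from 1, such that the [i]-th entry
    of [s] is at least [k]. *)
Definition last_ge (s : seq nat) (k : nat) : nat :=
  \max_(i < size s | k <= nth 0 s i) i.+1.

Definition conjugate_seq (s : seq nat) : seq nat :=
  [seq last_ge s k | k <- iota 1 (head 0 s)].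

Lemma conjugate_subproof (l : int_partition) : is_partition (conjugate_seq l).
Proof.
apply/andP; split.
  apply: (homo_sorted (e := leq)); last exact: iota_sorted.
  move=> a b ab; apply/bigmax_leqP => i bi.
  by apply: leq_bigmax_cond; apply: leq_trans bi.
apply/allP=> _ /mapP[k + ->]; rewrite mem_iota /last_ge add1n ltnS.
case: (parts l) => [|x s] /= /andP[k0 kx]; first by case: k k0 kx.
by apply: leq_trans (leq_bigmax_cond (ord0 : 'I_(size s).+1) kx).
Qed.

Definition conjugate (l : int_partition) : int_partition :=
  Partition (conjugate_subproof l).

Lemma delete_subproof (l : int_partition) (i : nat) :
  is_partition (take i l ++ drop i.+1 l).
Proof.
have /andP[sl pl] := partitionP l.
have sub : subseq (take i l ++ drop i.+1 l) l.
  rewrite -{3}(cat_take_drop i l) cat_subseq //.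
  by rewrite -addn1 addnC -drop_drop drop_subseq.
apply/andP; split.
  by apply: subseq_sorted sub sl => a b c /= ba cb; apply: leq_trans cb ba.
by apply/allP=> x /(mem_subseq sub); apply: (allP pl).
Qed.

(** Deletes the part with 0-based index [i]. *)
Definition delete_part (l : int_partition) (i : nat) : int_partition :=
  Partition (delete_subproof l i).

Definition row_move (l m : int_partition) : Prop :=
  exists2 i, i < size l & m = delete_part l i.

Definition column_move (l m : int_partition) : Prop :=
  exists2 n, row_move (conjugate l) n & m = conjugate n.

Definition crim_move (l m : int_partition) : Prop := row_move l m \/ column_move l m.

(** Normal play, where [move p q] says that the player to move at [p] may move
    to [q].  The player who has just moved can force a win from [p] when every
    move available to the opponent (possibly none) leads to a position from
    which the player then to move can force a win; inductiveness makes every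
    forced win occur after finitely many moves. *)
Inductive P_position (T : Type) (move : T -> T -> Prop) (p : T) : Prop :=
  | P_intro : (forall q, move p q -> N_position move q) -> P_position move p
with N_position (T : Type) (move : T -> T -> Prop) (p : T) : Prop :=
  | N_intro q : move p q -> P_position move q -> N_position move p.

Definition rectair_seq (r c k : nat) : seq nat :=
  nseq (r - k) c ++ [seq c - j | j <- iota 1 k].

Definition nonempty_rectair (l : int_partition) (r c k : nat) : Prop :=
  [/\ 0 < r, 0 < c, k < minn r c & l = rectair_seq r c k :> seq nat].

Definition rectair (l : int_partition) : Prop :=
  l = empty_partition \/ exists r c k, nonempty_rectair l r c k.

(** The parameters [r], [c], [k] are determined by [l]. *)
Definition balanced (l : int_partition) : Prop :=
  l = empty_partition \/
  exists r c k, nonempty_rectair l r c k /\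
    [/\ ~~ odd (rank l), 2 <= r, 2 <= c
      & odd r -> odd c -> k < minn r c - 1].

(* Main.v *)
Require Import Defs.
From mathcomp Require Import all_boot ssrint.
From mathcomp Require Import zify.

(** Every partition of odd rank is an N-position.  By induction, let [l] have
    odd rank and at least three rows and columns, the other cases being direct.
    If [l] without its first row and column has odd rank, then it has a winning
    move, and deleting the same row or column from [l] wins.  Otherwise exactly
    one of [l1 - l2] and [l'1 - l'2] is odd, and deleting the last column,
    respectively the last row, leaves a partition of even rank all of whose
    moves lead to odd rank.
    From a rectair of even rank with at least two rows and columns, only the
    first row or column can be deleted without making the rank odd, and only
    when [k] is maximal; this yields a rectair with [r], [c] and [k] all
    decreased by one, so that in this case P and N alternate down to a single
    row or column, which is an N-position. *)

(** * Young diagrams cell by cell *)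

Definition cell (l : int_partition) (i j : nat) : bool := j < nth 0 l i.

Definition delete_column (l : int_partition) (j : nat) : int_partition :=
  conjugate (delete_part (conjugate l) j).

Lemma nth_partition_geq (l : int_partition) i j : i <= j -> nth 0 l j <= nth 0 l i.
Proof.
move=> ij; have /andP[sl _] := partitionP l.
case: (ltnP j (size l)) => [jl|lj]; last by rewrite (nth_default _ lj).
have geq_trans : transitive geq by move=> a b c /= ba cb; apply: leq_trans cb ba.
by apply: (sorted_leq_nth geq_trans leqnn 0 sl); rewrite // inE (leq_ltn_trans ij).
Qed.

Lemma cell_size (l : int_partition) i : cell l i 0 = (i < size l).
Proof.
have /andP[_ pl] := partitionP l; rewrite /cell.
case: (ltnP i (size l)) => il; last by rewrite nth_default.
by have /all_nthP := pl; apply.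
Qed.

Lemma cell_head (l : int_partition) j : cell l 0 j = (j < head 0 l).
Proof. by rewrite /cell nth0. Qed.

(** With this, identities between partitions reduce to index computations: conjugation swaps the
    indices and a deletion reindexes by [bump]. *)
Lemma cell_inj (l : int_partition) m : cell l =2 cell m -> l = m.
Proof.
move=> e.
have nthe i : nth 0 l i = nth 0 m i.
  (* Two naturals with the same strict lower bounds agree; testing at each of the two is enough.
     Many equalities below are obtained in this way. *)
  have := e i (nth 0 m i); have := e i (nth 0 l i); rewrite /cell; lia.
have sizee : size l = size m.
  have := e (size m) 0; have := e (size l) 0; rewrite !cell_size; lia.
have: parts l = parts m by apply: (@eq_from_nth _ 0).
case: l m {e nthe sizee} => [s ps] [t pt] /= st.
by case: _ / st pt => pt; rewrite (bool_irrelevance ps pt).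
Qed.

(** Row lengths decrease, so the rows longer than [i] form an initial segment, and the last such row
    also counts them. *)
Lemma cell_conjugate (l : int_partition) i j : cell (conjugate l) i j = cell l j i.
Proof.
rewrite /cell /= /conjugate_seq.
case: (ltnP i (head 0 l)) => il; last first.
  rewrite nth_default ?size_map ?size_iota // ltn0.
  by have := nth_partition_geq l 0 j isT; rewrite nth0; lia.
rewrite (nth_map 0) ?size_iota // nth_iota // add1n /last_ge.
apply/idP/idP => [|ij].
  apply: contraTT; rewrite -!leqNgt => ji; apply/bigmax_leqP => k ik.
  rewrite ltnNge; apply/negP => jk.
  by have := nth_partition_geq l j k jk; lia.
have jl : j < size l by rewrite -cell_size /cell; lia.
exact: (@leq_bigmax_cond _ _ _ (Ordinal jl)).
Qed.

Lemma cell_delete_part (l : int_partition) i a b :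
  cell (delete_part l i) a b = cell l (bump i a) b.
Proof.
rewrite /cell /= nth_cat size_take /bump.
case: (ltnP i (size l)) => il.
  case: (ltnP a i) => ai; first by rewrite nth_take // leqNgt ai.
  by rewrite nth_drop; congr (_ < nth _ _ _); lia.
rewrite drop_oversize ?take_oversize ?nth_nil //; last by lia.
by case: ifP => al; [congr (_ < nth _ _ _) | rewrite nth_default]; lia.
Qed.

Lemma cell_delete_column (l : int_partition) j a b :
  cell (delete_column l j) a b = cell l a (bump j b).
Proof. by rewrite cell_conjugate cell_delete_part cell_conjugate. Qed.

Lemma conjugateK : involutive conjugate.
Proof. by move=> l; apply: cell_inj => i j; rewrite !cell_conjugate. Qed.

Lemma size_conjugate (l : int_partition) : size (conjugate l) = head 0 l.
Proof. by rewrite /= size_map size_iota. Qed.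

Lemma head_conjugate (l : int_partition) : head 0 (conjugate l) = size l.
Proof. by rewrite -size_conjugate conjugateK. Qed.

Lemma size_delete_part (l : int_partition) i :
  i < size l -> size (delete_part l i) = (size l).-1.
Proof. by move=> il; rewrite /= size_cat size_takel ?size_drop; lia. Qed.

Lemma head_delete_part (l : int_partition) i :
  head 0 (delete_part l i) = nth 0 l (bump i 0).
Proof.
have e b := cell_delete_part l i 0 b; rewrite /cell nth0 in e.
have := e (nth 0 l (bump i 0)); have := e (head 0 (delete_part l i)); lia.
Qed.

Lemma size_delete_column (l : int_partition) j :
  size (delete_column l j) = nth 0 (conjugate l) (bump j 0).
Proof. by rewrite size_conjugate head_delete_part. Qed.

Lemma head_delete_part0 (l : int_partition) : head 0 (delete_part l 0) = nth 0 l 1.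
Proof. exact: head_delete_part. Qed.

Lemma size_delete_column0 (l : int_partition) :
  size (delete_column l 0) = nth 0 (conjugate l) 1.
Proof. exact: size_delete_column. Qed.

Lemma head_delete_column (l : int_partition) j :
  j < head 0 l -> head 0 (delete_column l j) = (head 0 l).-1.
Proof.
by move=> jl; rewrite head_conjugate size_delete_part size_conjugate.
Qed.

Lemma nth_conjugate1_leq (l : int_partition) : nth 0 (conjugate l) 1 <= size l.
Proof. by rewrite -head_conjugate -nth0; apply: nth_partition_geq. Qed.

(** * Moves, and symmetry of the game under conjugation *)

Lemma crim_moveP (l : int_partition) m :
  crim_move l m <->
  (exists2 i, i < size l & m = delete_part l i) \/
  (exists2 j, j < head 0 l & m = delete_column l j).
Proof.
split=> [[|[n [j jl ->] ->]]|[|[j jl ->]]]; [by left| |by left|].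
  by right; exists j; rewrite // -size_conjugate.
by right; exists (delete_part (conjugate l) j) => //; exists j; rewrite ?size_conjugate.
Qed.

Lemma crim_move_row (l : int_partition) i :
  i < size l -> crim_move l (delete_part l i).
Proof. by move=> il; left; exists i. Qed.

Lemma crim_move_column (l : int_partition) j :
  j < head 0 l -> crim_move l (delete_column l j).
Proof. by move=> jl; apply/crim_moveP; right; exists j. Qed.

Lemma crim_move_conjugate (l : int_partition) m :
  crim_move l m -> crim_move (conjugate l) (conjugate m).
Proof.
move/crim_moveP=> [[i il ->]|[j jl ->]]; apply/crim_moveP.
  right; exists i; first by rewrite head_conjugate.
  by rewrite /delete_column conjugateK.
by left; exists j; rewrite ?size_conjugate // conjugateK.
Qed.

(* Mutual induction supplies hypotheses across the two predicates, so facts about P and N can be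
   proved together. *)
Scheme P_position_mut := Minimality for P_position Sort Prop
  with N_position_mut := Minimality for N_position Sort Prop.

Lemma P_position_not_N (T : Type) (move : T -> T -> Prop) p :
  P_position move p -> ~ N_position move p.
Proof.
apply: (P_position_mut _ _ (fun p => ~ N_position move p) (fun p => ~ P_position move p)).
  by move=> {}p _ IH [q /IH].
by move=> {}p q pq _ IH [/(_ _ pq)].
Qed.

Lemma P_position_conjugate (l : int_partition) :
  P_position crim_move l -> P_position crim_move (conjugate l).
Proof.
apply: (P_position_mut _ _ (fun l => P_position crim_move (conjugate l))
                           (fun l => N_position crim_move (conjugate l))).
  move=> {}l _ IH; split=> m /crim_move_conjugate; rewrite conjugateK => /IH.
  by rewrite conjugateK.
by move=> {}l m /crim_move_conjugate lm _ Pm; apply: N_intro lm Pm.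
Qed.

Lemma N_position_conjugate (l : int_partition) :
  N_position crim_move (conjugate l) -> N_position crim_move l.
Proof.
move=> [m /crim_move_conjugate]; rewrite conjugateK => lm.
by move/P_position_conjugate; apply: N_intro.
Qed.

(** * Parity of the rank *)

(** A sum has the parity of the absolute difference and keeps the arithmetic in [nat]. *)
Definition odd_rank (l : int_partition) : bool := odd (size l + head 0 l).

Lemma odd_rankE (l : int_partition) : odd (rank l) = odd_rank l.
Proof. by rewrite /rank /odd_rank; lia. Qed.

Lemma odd_rank_conjugate (l : int_partition) : odd_rank (conjugate l) = odd_rank l.
Proof. by rewrite /odd_rank size_conjugate head_conjugate addnC. Qed.

Lemma P_position_empty (l : int_partition) : size l = 0 -> P_position crim_move l.
Proof.
move=> l0; split=> m /crim_moveP[[i]|[j]]; first by rewrite l0.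
by move/size0nil: l0 => ->.
Qed.

Lemma N_position_single_row (l : int_partition) :
  size l = 1 -> N_position crim_move l.
Proof.
move=> l1; apply: (@N_intro _ _ _ (delete_part l 0)).
  by apply: crim_move_row; rewrite l1.
by apply: P_position_empty; rewrite size_delete_part l1.
Qed.

Lemma N_position_single_column (l : int_partition) :
  head 0 l = 1 -> N_position crim_move l.
Proof.
by rewrite -size_conjugate => /N_position_single_row/N_position_conjugate.
Qed.

(** Deleting any row or column but the first changes the parity of the rank. *)
Lemma P_position_even (l : int_partition) :
  ~~ odd_rank l ->
  (forall m, crim_move l m -> odd_rank m -> N_position crim_move m) ->
  (~~ odd_rank (delete_part l 0) -> N_position crim_move (delete_part l 0)) ->
  (~~ odd_rank (delete_column l 0) -> N_position crim_move (delete_column l 0)) ->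
  P_position crim_move l.
Proof.
move=> el IH NA NB; split=> m lm; case: (boolP (odd_rank m)) => om; first exact: IH.
have /crim_moveP[[[|i] il em]|[[|j] jl em]] := lm; subst m; [exact: NA| |exact: NB|].
  by move: el om; rewrite /odd_rank size_delete_part // head_delete_part /bump nth0; lia.
move: el om; rewrite /odd_rank size_delete_column head_delete_column // /bump.
by rewrite nth0 head_conjugate; lia.
Qed.

(** * Removing the first row and column *)

Definition hook_removal (l : int_partition) : int_partition :=
  delete_column (delete_part l 0) 0.

Lemma cell_hook_removal (l : int_partition) i j :
  cell (hook_removal l) i j = cell l i.+1 j.+1.
Proof. by rewrite cell_delete_column cell_delete_part. Qed.

Lemma hook_removal_conjugate (l : int_partition) :
  hook_removal (conjugate l) = conjugate (hook_removal l).
Proof. by apply: cell_inj => i j; rewrite !(cell_conjugate, cell_hook_removal). Qed.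

(** Either order of deletion shifts cells by one along the diagonal, so the result is also reached
    by a row move after the first column is gone. *)
Lemma hook_removalE (l : int_partition) :
  hook_removal l = delete_part (delete_column l 0) 0.
Proof.
by apply: cell_inj => i j; rewrite cell_hook_removal cell_delete_part cell_delete_column.
Qed.

Lemma hook_removal_delete_part (l : int_partition) i :
  hook_removal (delete_part l i.+1) = delete_part (hook_removal l) i.
Proof.
by apply: cell_inj => a b; rewrite !(cell_delete_part, cell_hook_removal) bumpS.
Qed.

(** The surviving rows are those below the first with a second cell; the truncated predecessor
    covers a missing second column. *)
Lemma size_hook_removal (l : int_partition) :
  size (hook_removal l) = (nth 0 (conjugate l) 1).-1.
Proof.
have e i : (i < size (hook_removal l)) = (i.+1 < nth 0 (conjugate l) 1).
  by rewrite -cell_size cell_hook_removal -cell_conjugate.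
have := e (size (hook_removal l)); have := e (nth 0 (conjugate l) 1).-1.
have := e (nth 0 (conjugate l) 1).-2; lia.
Qed.

Lemma head_hook_removal (l : int_partition) :
  head 0 (hook_removal l) = (nth 0 l 1).-1.
Proof.
by rewrite -size_conjugate -hook_removal_conjugate size_hook_removal conjugateK.
Qed.

(** Both children of [l] that can have even rank have [hook_removal l] as a child. *)
Lemma P_position_hook_removal (l : int_partition) :
  ~~ odd_rank l -> 1 < size l -> 1 < head 0 l ->
  (forall m, crim_move l m -> odd_rank m -> N_position crim_move m) ->
  P_position crim_move (hook_removal l) -> P_position crim_move l.
Proof.
move=> el r2 c2 IH Pl; apply: P_position_even => // _; apply: N_intro (Pl).
  by apply: crim_move_column; rewrite head_delete_part0; move: r2; rewrite -cell_size.
rewrite hook_removalE; apply: crim_move_row; rewrite size_delete_column0.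
by move: c2; rewrite -size_conjugate -cell_size.
Qed.

Lemma crim_move_weight (l : int_partition) m :
  crim_move l m -> size m + head 0 m < size l + head 0 l.
Proof.
move/crim_moveP=> [[i il ->]|[j jl ->]].
  rewrite size_delete_part // head_delete_part.
  by have := nth_partition_geq l 0 (bump i 0) isT; rewrite nth0; lia.
rewrite head_delete_column // size_delete_column.
have := nth_partition_geq (conjugate l) 0 (bump j 0) isT.
by rewrite nth0 head_conjugate; lia.
Qed.

(** * Odd rank gives an N-position *)

(** The induction hypothesis of [N_position_odd_rank]. Its measure is symmetric under conjugation
    and drops at every move. *)
Definition smaller_odd_N (l : int_partition) : Prop :=
  forall m : int_partition, size m + head 0 m < size l + head 0 l -> odd_rank m ->
  N_position crim_move m.

Lemma smaller_odd_N_conjugate (l : int_partition) :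
  smaller_odd_N l -> smaller_odd_N (conjugate l).
Proof.
by move=> IH m; rewrite size_conjugate head_conjugate (addnC (head 0 l)); apply: IH.
Qed.

Lemma smaller_odd_N_move (l : int_partition) m : smaller_odd_N l -> crim_move l m ->
  forall n, crim_move m n -> odd_rank n -> N_position crim_move n.
Proof.
by move=> IH /crim_move_weight lm n /crim_move_weight mn; apply: IH; apply: ltn_trans lm.
Qed.

(** Deleting row [i.+1] of [l] gives even rank and a hook removal that is the given P-position.
    Three rows are required so that two remain for [P_position_hook_removal]. *)
Lemma N_position_lift_row (l : int_partition) i :
  smaller_odd_N l -> odd_rank l -> 2 < size l -> 1 < head 0 l ->
  P_position crim_move (delete_part (hook_removal l) i) ->
  i < size (hook_removal l) -> N_position crim_move l.
Proof.
move=> IH ol r3 c2 Pi; rewrite size_hook_removal => il.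
have il1 : i.+1 < size l by have := nth_conjugate1_leq l; lia.
have lm := crim_move_row _ _ il1; apply: (N_intro lm).
apply: P_position_hook_removal; last by rewrite hook_removal_delete_part.
- move: ol; rewrite /odd_rank size_delete_part // head_delete_part nth0; lia.
- by rewrite size_delete_part //; lia.
- by rewrite head_delete_part nth0.
exact: smaller_odd_N_move lm.
Qed.

(** Deleting the second column preserves both rows and leaves an even width. From there, deleting
    the first row leaves a single row, and deleting the first column leaves a single row or an odd
    rank. *)
Lemma N_position_two_rows (l : int_partition) :
  smaller_odd_N l -> odd_rank l -> size l = 2 -> 1 < head 0 l ->
  N_position crim_move l.
Proof.
move=> IH ol r2 c2; have lm := crim_move_column _ _ c2; apply: (N_intro lm).
have hm := head_delete_column _ _ c2.
have sm : size (delete_column l 1) = 2.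
  by rewrite size_delete_column nth0 head_conjugate.
apply: P_position_even.
- by move: ol; rewrite /odd_rank hm sm r2; lia.
- exact: smaller_odd_N_move lm.
- by move=> _; apply: N_position_single_row; rewrite size_delete_part sm.
move=> en; case: (ltnP 1 (nth 0 (conjugate (delete_column l 1)) 1)) => h.
  have le2 := nth_conjugate1_leq (delete_column l 1).
  by exfalso; move: ol en; rewrite /odd_rank size_delete_column0 head_delete_column; lia.
move: h; rewrite leq_eqVlt ltnS leqn0 => /orP[/eqP h|/eqP h].
  by apply: N_position_single_row; rewrite size_delete_column0.
(* The width of [l] is odd and above one, hence at least three, so a second column remains. *)
suff: 0 < nth 0 (conjugate (delete_column l 1)) 1 by rewrite h.
by rewrite -/(cell _ 1 0) cell_size size_conjugate hm; move: ol; rewrite /odd_rank; lia.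
Qed.

(** By [o1] the first row is strictly longer than the second, so the last column is a single cell
    and deleting it only shortens the first row. *)
Lemma N_position_delete_last_column (l : int_partition) :
  smaller_odd_N l -> odd_rank l -> 1 < size l -> 2 < head 0 l ->
  ~~ odd_rank (hook_removal l) -> odd (head 0 l + nth 0 l 1) ->
  N_position crim_move l.
Proof.
move=> IH ol r2 c3 eh o1.
have jl : (head 0 l).-1 < head 0 l by lia.
have l1 : 0 < nth 0 l 1 by move: r2; rewrite -cell_size.
have l1' : 0 < nth 0 (conjugate l) 1.
  by rewrite -/(cell _ _ _) cell_conjugate cell_head; lia.
have l1h := nth_partition_geq l 0 1 isT; rewrite nth0 in l1h.
have lm := crim_move_column _ _ jl; apply: (N_intro lm).
move: lm; set m := delete_column _ _ => lm.
have hm : head 0 m = (head 0 l).-1 by apply: head_delete_column.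
have sm : size m = size l.
  by rewrite size_delete_column /bump leqNgt (_ : 0 < _) ?nth0 ?head_conjugate; lia.
have m1 : nth 0 m 1 = nth 0 l 1.
  have e b := cell_delete_column l (head 0 l).-1 1 b; rewrite -/m /cell /bump in e.
  by have := e (nth 0 l 1); have := e (nth 0 m 1); lia.
(* With at least three columns, the second is not the deleted one. *)
have m1' : nth 0 (conjugate m) 1 = nth 0 (conjugate l) 1.
  rewrite /m /delete_column conjugateK.
  have e b := cell_delete_part (conjugate l) (head 0 l).-1 1 b.
  rewrite /cell (_ : bump _ 1 = 1) in e; last by rewrite /bump; lia.
  have := e (nth 0 (conjugate l) 1).
  by have := e (nth 0 (delete_part (conjugate l) (head 0 l).-1) 1); lia.
(* By [l1] and [l1'] the predecessors in the size of the hook removal do not truncate. *)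
have oh : ~~ odd (nth 0 (conjugate l) 1 + nth 0 l 1).
  by move: eh; rewrite /odd_rank size_hook_removal head_hook_removal; lia.
apply: P_position_even.
- by move: ol; rewrite /odd_rank hm sm; lia.
- exact: smaller_odd_N_move lm.
- rewrite /odd_rank size_delete_part ?sm ?head_delete_part0 ?m1; last by lia.
  by move: ol; rewrite /odd_rank; lia.
rewrite /odd_rank size_delete_column0 head_delete_column ?hm ?m1'; last by lia.
by move: ol; rewrite /odd_rank; lia.
Qed.

Lemma N_position_odd_rank (l : int_partition) :
  odd_rank l -> N_position crim_move l.
Proof.
have [n] := ubnP (size l + head 0 l); elim: n l => // n IHn l ln ol.
have IH : smaller_odd_N l by move=> m ml; apply: IHn; lia.
have IH' := smaller_odd_N_conjugate _ IH.
have ol' : odd_rank (conjugate l) by rewrite odd_rank_conjugate.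
have l0 : 0 < size l.
  by rewrite lt0n; apply/negP => /eqP/size0nil le; move: ol; rewrite /odd_rank le.
have c0 : 0 < head 0 l by rewrite -cell_head cell_size.
have [r1|r1] := eqVneq (size l) 1; first exact: N_position_single_row.
have [c1|c1] := eqVneq (head 0 l) 1; first exact: N_position_single_column.
have [r2|r2] := eqVneq (size l) 2; first by apply: N_position_two_rows => //; lia.
have [c2|c2] := eqVneq (head 0 l) 2.
  apply: N_position_conjugate; apply: N_position_two_rows => //.
    by rewrite size_conjugate.
  by rewrite head_conjugate; lia.
case: (boolP (odd_rank (hook_removal l))) => oh.
  have [|m /crim_moveP[[i il ->]|[j jl ->]] Pm] := IHn _ _ oh.
  - have := nth_conjugate1_leq l; have := nth_partition_geq l 0 1 isT.
    by rewrite size_hook_removal head_hook_removal nth0; lia.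
  - by apply: (N_position_lift_row _ i) => //; lia.
  apply: N_position_conjugate; apply: (N_position_lift_row _ j) => //.
  - by rewrite size_conjugate; lia.
  - by rewrite head_conjugate; lia.
  - rewrite hook_removal_conjugate.
    by move/P_position_conjugate: Pm; rewrite /delete_column conjugateK.
  by rewrite hook_removal_conjugate size_conjugate.
case: (boolP (odd (head 0 l + nth 0 l 1))) => o1.
  by apply: N_position_delete_last_column => //; lia.
(* Odd rank of [l] and even rank of its hook removal force the first two columns to differ by an odd
   amount, so the conjugate falls under the previous case. *)
apply: N_position_conjugate; apply: N_position_delete_last_column => //.
- by rewrite size_conjugate; lia.
- by rewrite head_conjugate; lia.
- by rewrite hook_removal_conjugate odd_rank_conjugate.
have l1 : 0 < nth 0 l 1 by rewrite -/(cell l 1 0) cell_size; lia.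
have l1' : 0 < nth 0 (conjugate l) 1.
  by rewrite -/(cell _ _ _) cell_conjugate cell_head; lia.
move: ol oh; rewrite /odd_rank size_hook_removal head_hook_removal head_conjugate.
by lia.
Qed.

(** * Rectairs *)

(** The last inequality cuts the [k] outermost antidiagonals off the bottom right corner. This form
    is visibly symmetric in rows and columns. *)
Definition rectair_shape (l : int_partition) (r c k : nat) : Prop :=
  forall i j, cell l i j = [&& i < r, j < c & i + j + 1 + k < r + c].

Lemma nonempty_rectair_rectair_shape (l : int_partition) r c k :
  nonempty_rectair l r c k -> rectair_shape l r c k.
Proof.
move=> [r0 c0 krc el] i j; rewrite /cell el /rectair_seq nth_cat size_nseq.
rewrite nth_nseq; case: ifP => ir; first by rewrite ir; lia.
case: (ltnP i r) => ri; last by rewrite nth_default // size_map size_iota; lia.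
by rewrite (nth_map 0) ?size_iota ?nth_iota; lia.
Qed.

Lemma rectair_shape_conjugate (l : int_partition) r c k :
  rectair_shape l r c k -> rectair_shape (conjugate l) c r k.
Proof. by move=> sl i j; rewrite cell_conjugate sl; lia. Qed.

Lemma rectair_shape_size (l : int_partition) r c k :
  k < minn r c -> rectair_shape l r c k -> size l = r.
Proof.
move=> krc sl; have e i : (i < size l) = (i < r) by rewrite -cell_size sl; lia.
by have := e r; have := e (size l); lia.
Qed.

Lemma rectair_shape_head (l : int_partition) r c k :
  k < minn r c -> rectair_shape l r c k -> head 0 l = c.
Proof.
move=> krc /rectair_shape_conjugate sl; rewrite -size_conjugate.
by apply: rectair_shape_size sl; rewrite minnC.
Qed.

(** For maximal [k] and [r <= c] all rows have different lengths, so losing the first row also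
    lowers the width by one. *)
Lemma rectair_shape_delete_part (l : int_partition) r c :
  1 < r <= c -> rectair_shape l r c r.-1 -> rectair_shape (delete_part l 0) r.-1 c.-1 r.-2.
Proof. by move=> rc sl i j; rewrite cell_delete_part sl /bump; lia. Qed.

Lemma rectair_shape_inj (l : int_partition) m r c k :
  rectair_shape l r c k -> rectair_shape m r c k -> l = m.
Proof. by move=> sl sm; apply: cell_inj => i j; rewrite sl sm. Qed.

Lemma PN_position_maximal_k r c (l : int_partition) :
  0 < r <= c -> ~~ odd (r + c) -> rectair_shape l r c r.-1 ->
  if odd r then N_position crim_move l else P_position crim_move l.
Proof.
elim: r c l => [|[|r] IH] c l // rc erc sl.
  by apply: N_position_single_row; apply: rectair_shape_size sl; lia.
have sA := rectair_shape_delete_part _ _ _ _ sl.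
have := IH c.-1 _ _ _ (sA _).
have szl := rectair_shape_size _ _ _ _ _ sl; have hdl := rectair_shape_head _ _ _ _ _ sl.
move=> /(_ ltac:(lia) ltac:(lia) ltac:(lia)) /=; case: (odd r) => /= IHA.
  by apply: N_intro IHA; apply: crim_move_row; rewrite szl; lia.
apply: P_position_even => //; first by rewrite /odd_rank szl ?hdl; lia.
  by move=> m _; apply: N_position_odd_rank.
(* If [c] exceeds the number of rows, the even rank makes the last row at least two cells long, so
   deleting the first column keeps every row and makes the rank odd. *)
case: (ltnP r.+2 c) => cr.
  rewrite /odd_rank head_delete_column ?hdl ?size_delete_column0; try lia.
  have e b : cell (conjugate l) 1 b = (b < r.+2) by rewrite cell_conjugate sl; lia.
  have := e (nth 0 (conjugate l) 1); have := e r.+2; have := e r.+1.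
  by rewrite /cell => *; exfalso; lia.
(* In the square case the staircase is self-conjugate, and the first column behaves like the first
   row. *)
move=> _; apply: N_position_conjugate; rewrite conjugateK.
have -> // : conjugate l = l.
have ec : c = r.+2 by lia.
by rewrite ec in sl; exact: rectair_shape_inj (rectair_shape_conjugate _ _ _ _ sl) sl.
Qed.

(** Below the maximal [k], the first two rows are equal and so are the first two columns, so every
    move leads to odd rank. *)
Lemma P_position_small_k r c (l : int_partition) k :
  k.+1 < minn r c -> ~~ odd (r + c) -> rectair_shape l r c k -> P_position crim_move l.
Proof.
move=> krc erc sl.
have szl := rectair_shape_size _ _ _ _ _ sl; have hdl := rectair_shape_head _ _ _ _ _ sl.
have l1 : nth 0 l 1 = c.
  have e b : cell l 1 b = (b < c) by rewrite sl; lia.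
  by have := e c; have := e (nth 0 l 1); rewrite /cell; lia.
have l1' : nth 0 (conjugate l) 1 = r.
  have e b : cell (conjugate l) 1 b = (b < r) by rewrite cell_conjugate sl; lia.
  by have := e r; have := e (nth 0 (conjugate l) 1); rewrite /cell; lia.
apply: P_position_even; rewrite /odd_rank.
- by rewrite szl ?hdl; lia.
- by move=> m _; apply: N_position_odd_rank.
- by rewrite size_delete_part ?head_delete_part0 ?szl ?l1; lia.
by rewrite head_delete_column ?size_delete_column0 ?hdl ?l1'; lia.
Qed.

Lemma PN_position_rectair r c k (l : int_partition) :
  k < minn r c -> rectair_shape l r c k ->
  if [&& ~~ odd_rank l, 1 < r, 1 < c & odd r ==> odd c ==> (k.+1 < minn r c)]
  then P_position crim_move l else N_position crim_move l.
Proof.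
move=> krc sl.
have szl := rectair_shape_size _ _ _ _ krc sl; have hdl := rectair_shape_head _ _ _ _ krc sl.
case: (boolP (odd_rank l)) => [|el] /=; first exact: N_position_odd_rank.
have erc : ~~ odd (r + c) by move: el; rewrite /odd_rank szl hdl.
case: (ltnP 1 r) => r1 /=; last by apply: N_position_single_row; lia.
case: (ltnP 1 c) => c1 /=; last by apply: N_position_single_column; lia.
case: (ltnP k.+1 (minn r c)) => km.
  by rewrite !implybT; apply: P_position_small_k sl.
have oe : odd c = odd r by lia.
case: (leqP r c) => rc.
  have ek : k = r.-1 by lia.
  rewrite ek in sl; have := PN_position_maximal_k _ _ _ _ erc sl.
  by move=> /(_ ltac:(lia)); rewrite oe; case: (odd r).
(* [PN_position_maximal_k] expects the shorter side first, hence the conjugate. *)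
have ek : k = c.-1 by lia.
rewrite ek in sl; have := PN_position_maximal_k c r _ _ _ (rectair_shape_conjugate _ _ _ _ sl).
move=> /(_ ltac:(lia) ltac:(lia)); rewrite oe; case: (odd r) => /=.
  exact: N_position_conjugate.
by move/P_position_conjugate; rewrite conjugateK.
Qed.

Theorem corollary1 (l : int_partition) (hl : rectair l) :
  P_position crim_move l <-> balanced l.
Proof.
split=> [Pl|[->|[r [c [k [hrck [el r2 c2 ho]]]]]]]; last first.
- have krc : k < minn r c by case: hrck.
  have := PN_position_rectair _ _ _ _ krc (nonempty_rectair_rectair_shape _ _ _ _ hrck).
  rewrite -odd_rankE el r2 c2 /=; case: ifP => // /negP[].
  by apply/implyP => or; apply/implyP => oc; have := ho or oc; lia.
- exact: P_position_empty.
case: hl => [->|[r [c [k hrck]]]]; first by left.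
right; exists r, c, k; split=> //.
have krc : k < minn r c by case: hrck.
have := PN_position_rectair _ _ _ _ krc (nonempty_rectair_rectair_shape _ _ _ _ hrck).
rewrite -odd_rankE; case: ifP => [/and4P[el r2 c2 ho] _|_ /(P_position_not_N _ _ _ Pl)//].
by split=> // or oc; move: ho; rewrite or oc; lia.
Qed.
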